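(* Let $S$ be a string of length $n$, and let $g$ be the size of a Straight-Line Program for $S$. Then $\Omega(\log n/\log\log n)$ time is needed to perform partial sum, rank, and select queries on $S$ with any static data structure using $O(g\,\mathrm{polylog}\,n)$ space.
   Context: A Straight-Line Program (SLP) is a context-free grammar generating exactly one string, with rules of the form $X\to AB$ ($A,B$ terminals or nonterminals); its size is the number of nonterminals. For a string $S[1..n]$ over an integer alphabet: $S.psum(i)=\sum_{j=1}^i S[j]$ (partial sum); $S.rank_c(i)$ is the number of occurrences of $c$ in $S[1..i]$; $S.select_c(i)$ is the position of the $i$-th occurrence of $c$ in $S$. The lower bound is for static data structures (space measured in machine words of $O(\log n)$ bits), as in the random-access lower bound of Verbin and Yu. *)

(* Defs.v *)
From mathcomp Require Import all_boot all_order all_algebra.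
From mathcomp Require Import all_classical all_reals all_analysis.

Set Implicit Arguments.
Unset Strict Implicit.
Unset Printing Implicit Defensive.

Import Order.TTheory GRing.Theory Num.Theory.
Import numFieldNormedType.Exports.

Local Open Scope classical_set_scope.
Local Open Scope ring_scope.

(* Context-free grammars over integer letters whose rules have the form
   X -> A B; a symbol is [inl a] (terminal) or [inr X] (nonterminal). *)
Definition symbol (g : nat) : Type := (int + 'I_g)%type.

Record grammar := Grammar {
  grammar_size : nat;
  rules : seq ('I_grammar_size * (symbol grammar_size * symbol grammar_size));
  start : 'I_grammar_size
}.

Inductive derives (G : grammar) : symbol (grammar_size G) -> seq int -> Prop :=
| derives_terminal a : derives (inl a) [:: a]
| derives_rule X A B u v :
    (X, (A, B)) \in rules G -> derives A u -> derives B v ->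
    derives (inr X) (u ++ v).

Definition is_slp_for (G : grammar) (S : seq int) : Prop :=
  forall T : seq int, derives (inr (start G)) T <-> T = S.

(* Positions in strings are numbered from 1: S[j] is [nth 0 S j.-1]. *)
Definition psum (S : seq int) (i : nat) : int :=
  \sum_(1 <= j < i.+1) nth 0 S j.-1.

Definition rank (c : int) (S : seq int) (i : nat) : nat :=
  count_mem c (take i S).

Definition occurrences (c : int) (S : seq int) : seq nat :=
  [seq j <- iota 1 (size S) | nth 0 S j.-1 == c].

Definition select (c : int) (S : seq int) (i : nat) : nat :=
  nth 0%N (occurrences c S) i.-1.

(* A query need only be answered on the strings for which it is legal. *)
Record problem := Problem {
  query : Type;
  answer : Type;
  legal : seq int -> query -> bool;
  solution : seq int -> query -> answer
}.

Definition psum_problem : problem :=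
  {| query := nat;
     answer := int;
     legal S i := (1 <= i <= size S)%N;
     solution S i := psum S i |}.

(* [Sigma n] is the alphabet of the strings of length n. *)
Definition rank_problem (Sigma : nat -> seq int) : problem :=
  {| query := int * nat;
     answer := nat;
     legal S q := (q.1 \in Sigma (size S)) && (1 <= q.2 <= size S)%N;
     solution S q := rank q.1 S q.2 |}.

Definition select_problem : problem :=
  {| query := int * nat;
     answer := nat;
     legal S q := (1 <= q.2 <= count_mem q.1 S)%N;
     solution S q := select q.1 S q.2 |}.

(* Adaptive query algorithms of the cell-probe model: only the cells read are
   charged, and the next step may depend arbitrarily on their contents. *)
Inductive probes (W A : Type) : Type :=
| Return of A
| Probe of nat & (W -> probes W A).

Definition word (w : nat) : Type := w.-tuple bool.

(* Cells outside the memory read as the zero word. *)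
Definition read (w : nat) (mem : seq (word w)) (a : nat) : word w :=
  nth [tuple of nseq w false] mem a.

Fixpoint run (w : nat) (A : Type) (mem : seq (word w))
    (p : probes (word w) A) : A :=
  match p with
  | Return x => x
  | Probe a k => run mem (k (read mem a))
  end.

Fixpoint cost (w : nat) (A : Type) (mem : seq (word w))
    (p : probes (word w) A) : nat :=
  match p with
  | Return _ => 0%N
  | Probe a k => (cost mem (k (read mem a))).+1
  end.

(* The preprocessing sees the string and the grammar and is unrestricted; the
   query algorithm knows only the length of the string, the size of the grammar
   and the query, and learns the rest by probing. *)
Record data_structure (P : problem) := DataStructure {
  word_size : nat -> nat;
  memory : forall S : seq int, grammar -> seq (word (word_size (size S)));
  algorithm : forall n : nat, nat -> query P ->
    probes (word (word_size n)) (answer P)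
}.

Definition instance (Sigma : nat -> seq int) (S : seq int) (G : grammar) : Prop :=
  {subset S <= Sigma (size S)} /\ is_slp_for G S.

Section DataStructures.
Context (P : problem) (Sigma : nat -> seq int) (D : data_structure P).

Definition solves : Prop :=
  forall (S : seq int) (G : grammar), instance Sigma S G ->
  forall q : query P, legal S q ->
  run (memory D S G) (algorithm D (size S) (grammar_size G) q) = solution S q.

Definition runs_in_time (t : nat -> nat) : Prop :=
  forall (S : seq int) (G : grammar), instance Sigma S G ->
  forall q : query P, legal S q ->
  (cost (memory D S G) (algorithm D (size S) (grammar_size G) q)
     <= t (size S))%N.

Definition logarithmic_words (R : realType) : Prop :=
  (fun n => (word_size D n)%:R : R) =O_\oo (fun n => ln (n%:R : R)).

(* Space O(g polylog n), in words. *)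
Definition near_grammar_space (R : realType) : Prop :=
  exists (C : R) (k n0 : nat),
  forall (S : seq int) (G : grammar), instance Sigma S G -> (n0 <= size S)%N ->
  (size (memory D S G))%:R <= C * (grammar_size G)%:R * ln (size S)%:R ^+ k.

End DataStructures.

Definition needs_time (R : realType) (Sigma : nat -> seq int) (P : problem)
    (f : nat -> R) : Prop :=
  forall (D : data_structure P) (t : nat -> nat),
    solves Sigma D -> logarithmic_words D R -> near_grammar_space Sigma D R ->
    runs_in_time Sigma D t ->
    (fun n => (t n)%:R : R) =Omega_\oo f.

(* Main.v *)
Require Import Defs.
From mathcomp Require Import all_boot all_order all_algebra.
From mathcomp Require Import all_classical all_reals all_analysis.
From mathcomp Require Import zify ring lra.

(* The hard strings have grammars of polylogarithmic size, so that the space s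
   is polylogarithmic too and there are only s^t = n^o(1) sequences of t
   addresses when t = o(log n / log log n).

   A table of bits x_j[l] (j < m, l < L), where L is polylogarithmic and m is of
   order log n / log log n, is encoded in a string of length n on which, for
   every digit sequence i in [L]^m, one query reveals the sum over j of
   x_j[i_j]. The string is built in m levels: level j+1 concatenates L copies of
   level j, where the l-th copy is put between the letters b, a if x_j[l] = 1 and
   a, b if x_j[l] = 0.

   Fix a table. By pigeonhole, a set Q of at least L^m / s^t queries read the same
   t addresses, so the t addresses and the contents of these cells determine Q
   and the answers on Q. Unless s^t is at least L^(m/2), some projection Q_j has
   more than sqrt L elements, so that the sums on Q determine x at more than
   sqrt L places once the rest of x is known. But t words and t addresses carry
   far fewer than sqrt L bits when L is a large power of log n. *)

Import Order.TTheory GRing.Theory Num.Theory.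
Import numFieldNormedType.Exports.

Set Implicit Arguments.
Unset Strict Implicit.
Unset Printing Implicit Defensive.

Local Open Scope ring_scope.

(** * Cell-probe lower bound for path sums *)

Lemma pigeonhole (T K : finType) (f : T -> K) (k0 : K) :
  exists k, (#|T| <= #|[set x | f x == k]| * #|K|)%N.
Proof.
pose c k := #|[set x | f x == k]|.
exists [arg max_(k > k0) c k]; case: arg_maxnP => //= k _ kmax.
have -> : #|T| = (\sum_k c k)%N.
  rewrite -cardsT -sum1_card (partition_big f predT) //=.
  by apply: eq_bigr => k' _; rewrite /c -sum1_card; apply: eq_bigl => x; rewrite !inE.
rewrite mulnC -sum_nat_const; apply: leq_sum => k' _; exact: kmax.
Qed.

Fixpoint trace (w : nat) (A : Type) (mem : seq (word w))
    (p : probes (word w) A) : seq nat :=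
  match p with
  | Return _ => [::]
  | Probe a k => a :: trace mem (k (read mem a))
  end.

Lemma size_trace (w : nat) (A : Type) (mem : seq (word w))
    (p : probes (word w) A) : size (trace mem p) = cost mem p.
Proof. by elim: p => //= a k IH; rewrite IH. Qed.

Lemma run_agree (w : nat) (A : Type) (mem mem' : seq (word w))
    (p : probes (word w) A) :
  {in trace mem p, read mem =1 read mem'} -> run mem p = run mem' p.
Proof.
elim: p => //= a k IH agree.
rewrite -agree ?mem_head //; apply: IH => b b_in.
by apply: agree; rewrite inE b_in orbT.
Qed.

Definition table (m L : nat) : finType := {ffun 'I_m * 'I_L -> bool}.
Definition digits (m L : nat) : finType := {ffun 'I_m -> 'I_L}.
Definition path_sum (m L : nat) (x : table m L) (i : digits m L) : nat :=
  (\sum_j x (j, i j))%N.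

Section ProbeLowerBound.
Variables (A : Type) (m r s t w : nat).
Local Notation table := (table m (r ^ 2)).
Local Notation digits := (digits m (r ^ 2)).

Variables (mem : table -> seq (word w)) (alg : digits -> probes (word w) A).
Hypothesis mem_size : forall x, (size (mem x) <= s)%N.
Hypothesis alg_cost : forall x i, (cost (mem x) (alg i) <= t)%N.
Hypothesis run_path_sum : forall x y i,
  run (mem x) (alg i) = run (mem y) (alg i) -> path_sum x i = path_sum y i.

(* All addresses beyond the memory are identified, as they read as zero. *)
Definition clipped_trace (x : table) (i : digits) : {ffun 'I_t -> 'I_s.+1} :=
  [ffun k : 'I_t => inord (minn s (nth s (trace (mem x) (alg i)) k))].

Lemma popular_traceP (x : table) :
  exists a, ((r ^ 2) ^ m <=
    #|[set i | clipped_trace x i == a]| * s.+1 ^ t)%N.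
Proof.
have [a] := pigeonhole (clipped_trace x) [ffun => ord0].
by rewrite !card_ffun !card_ord => H; exists a.
Qed.

Definition popular_trace (x : table) := xchoose (popular_traceP x).

(** It takes at most [s.+1 ^ t * 2 ^ (w * t)] values, yet it fixes the path sums at all queries with
    the popular trace. *)
Definition certificate (x : table) :
    {ffun 'I_t -> 'I_s.+1} * {ffun 'I_t -> word w} :=
  (popular_trace x, [ffun k => read (mem x) (popular_trace x k)]).

(** Each address probed on [x] is either beyond both memories, where both read zero, or an entry of
    the popular trace, whose content the certificate records. Hence the run on [y] repeats the run
    on [x]. *)
Lemma certificate_path_sum (x y : table) (i : digits) :
  certificate x = certificate y -> clipped_trace x i = popular_trace x ->
  path_sum x i = path_sum y i.
Proof.
move=> [eqa /ffunP eqc] tr; apply: run_path_sum; apply: run_agree => b b_in.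
have [sb|bs] := leqP s b.
  by rewrite /read !nth_default // (leq_trans (mem_size _)).
have k_lt : (index b (trace (mem x) (alg i)) < t)%N.
  apply: leq_trans (alg_cost x i); by rewrite -size_trace index_mem.
have := eqc (Ordinal k_lt); rewrite !ffunE -eqa.
suff -> : popular_trace x (Ordinal k_lt) = b :> nat by [].
rewrite -tr ffunE /= nth_index // inordK; lia.
Qed.

(* Tables with the same path sums on Q are determined by their bits outside
   {j} x Q_j. *)
Lemma card_same_path_sums (Q : {set digits}) (Y : {set table}) (j : 'I_m) :
  (forall x y i, x \in Y -> y \in Y -> i \in Q -> path_sum x i = path_sum y i) ->
  (#|Y| * 2 ^ #|[set i j | i : digits in Q]| <= #|{: table}|)%N.
Proof.
move=> eqY; set Qj := [set _ | _ in _].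
(* [phi] overwrites the bits on {j} x Q_j by an arbitrary subset of Q_j; its injectivity on pairs
   from Y and the powerset of Q_j gives the bound. *)
pose phi (xz : table * {set 'I_(r ^ 2)}) : table :=
  [ffun p => if (p.1 == j) && (p.2 \in Qj) then p.2 \in xz.2 else xz.1 p].
rewrite -card_powerset -cardsX -(card_in_imset (f := phi)) ?max_card //.
move=> [x z] [y u] /finset.setXP[/= xY zQ] /finset.setXP[/= yY uQ] /ffunP phiE.
rewrite !powersetE in zQ uQ.
have zu : z = u.
  apply/setP => l; have [lQ|lQ] := boolP (l \in Qj).
    by have := phiE (j, l); rewrite !ffunE /= eqxx lQ.
  by rewrite (contraNF (fintype.subsetP zQ l)) ?(contraNF (fintype.subsetP uQ l)).
have off p : ~~ ((p.1 == j) && (p.2 \in Qj)) -> x p = y p.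
  by move=> np; have := phiE p; rewrite !ffunE (negbTE np).
congr (_, _) => //; apply/ffunP => -[j' l].
have [/andP[/eqP /= -> lQ]|/off //] := boolP (((j', l).1 == j) && ((j', l).2 \in Qj)).
have [i iQ ->] := imsetP lQ.
(* The tables agree off {j} x Q_j, so equal path sums at a query whose j-th digit is [l] force equal
   bits at [(j, l)]. *)
have := eqY _ _ _ xY yY iQ; rewrite /path_sum (bigD1 j) //= [RHS](bigD1 j) //=.
rewrite (eq_bigr (fun j0 => (y (j0, i j0) : nat))).
  by move/addIn; case: (x _) (y _) => [] [].
by move=> j0 j0j; rewrite off //= negb_and j0j.
Qed.

(** Here L = r^2, so r is the threshold sqrt L. If (s+1)^t < r^m, more than r^m queries share a
    trace, one projection exceeds r, and more than r free bits must be paid for by the number of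
    certificates. *)
Lemma probe_lower_bound : (r ^ m <= s.+1 ^ t)%N \/ (2 ^ r < r ^ m * 2 ^ (w * t))%N.
Proof.
have [|st_lt] := leqP (r ^ m) (s.+1 ^ t); [by left|right].
have [[a c]] := pigeonhole certificate ([ffun => ord0], [ffun => [tuple of nseq w false]]).
set Y := [set x | _]; rewrite [X in (_ <= _ * X)%N](_ : _ = s.+1 ^ t * 2 ^ (w * t))%N; last first.
  by rewrite card_prod !card_ffun card_tuple card_bool !card_ord -expnM.
move=> leY.
have table_gt0 : (0 < #|{: table}|)%N by apply/card_gt0P; exists [ffun => false].
have Y_gt0 : (0 < #|Y|)%N.
  by rewrite lt0n; apply: contraTneq leY => ->; rewrite mul0n leqn0 -lt0n.
have /card_gt0P[x xY] := Y_gt0.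
pose Q := [set i | clipped_trace x i == a].
have certY y : y \in Y -> certificate y = (a, c) by rewrite inE => /eqP.
have popa y : y \in Y -> popular_trace y = a by move=> /certY/(congr1 fst).
have eqY y z i : y \in Y -> z \in Y -> i \in Q -> path_sum y i = path_sum z i.
  move=> yY zY; rewrite inE => /eqP iQ.
  have eqx u : u \in Y -> path_sum x i = path_sum u i.
    by move=> uY; apply: certificate_path_sum; rewrite ?certY ?popa.
  by rewrite -!eqx.
have leQ : (r ^ m * r ^ m <= #|Q| * s.+1 ^ t)%N.
  rewrite -expnMn mulnn; apply: leq_trans (xchooseP (popular_traceP x)) _.
  by rewrite -/(popular_trace x) popa.
(* Q lies in the product of its projections: if all had at most r elements, then |Q| <= r^m and r^m
   <= (s+1)^t. *)
have [j Qj_gt] : exists j : 'I_m, (r < #|[set i j | i : digits in Q]|)%N.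
  apply/existsP; apply: contraTT st_lt; rewrite negb_exists -leqNgt => /forallP Qj_le.
  have Q_le : (#|Q| <= r ^ m)%N.
    apply: (@leq_trans #|[pred i : digits | [forall j, i j \in [set i0 j | i0 : digits in Q]]]|).
      apply/subset_leq_card/fintype.subsetP => i iQ; rewrite inE; apply/forallP => j.
      by apply/imsetP; exists i.
    rewrite (_ : #|_| = #|family (fun j => [set i0 j | i0 : digits in Q])|); last first.
      by apply: eq_card => i; rewrite !inE.
    rewrite card_family foldrE big_map big_enum /= -[X in (_ <= r ^ X)%N](card_ord m).
    rewrite -prod_nat_const; by apply: leq_prod => j _; have := Qj_le j; rewrite -leqNgt.
  have [|rm] := posnP (r ^ m); first by move->.
  by rewrite -(leq_pmul2l rm) (leq_trans leQ) // leq_mul2r Q_le orbT.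
have := leq_trans (card_same_path_sums j eqY) leY.
rewrite leq_pmul2l // => le1.
have lt1 : (2 ^ r < 2 ^ #|[set i j | i : digits in Q]|)%N by rewrite ltn_exp2l.
apply: leq_trans lt1 _; apply: leq_trans le1 _.
by rewrite leq_mul2r (ltnW st_lt) orbT.
Qed.

End ProbeLowerBound.

(** * Grammars from chains of concatenations *)

Definition available (us : seq (seq int)) (v : seq int) : bool :=
  (size v == 1%N) || (v \in us).

(** A straight-line program written by its expansions: each entry is a nonterminal made of letters
    or earlier entries, which excludes cycles. *)
Definition concat_chain (us : seq (seq int)) : Prop :=
  forall i, (i < size us)%N -> exists u v,
    [/\ nth [::] us i = u ++ v, available (take i us) u & available (take i us) v].

Lemma available_sub (us vs : seq (seq int)) (v : seq int) :
  {subset us <= vs} -> available us v -> available vs v.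
Proof. by move=> sub /orP[v1|/sub vvs]; apply/orP; [left|right]. Qed.

Lemma concat_chain_cat (us vs : seq (seq int)) :
  concat_chain us -> concat_chain vs -> concat_chain (us ++ vs).
Proof.
move=> chu chv i; rewrite size_cat nth_cat take_cat => i_lt.
case: ltnP => [/chu //|le_i].
have [|u [v [-> avu avv]]] := chv (i - size us)%N; first lia.
by exists u, v; split=> //; [apply: available_sub avu|apply: available_sub avv] => z;
  rewrite mem_cat => ->; rewrite orbT.
Qed.

Lemma concat_chain_rcons (us : seq (seq int)) (u v : seq int) :
  concat_chain us -> available us u -> available us v ->
  concat_chain (rcons us (u ++ v)).
Proof.
move=> chu avu avv i; rewrite size_rcons ltnS => le_i.
rewrite -cats1 takel_cat // cats1 nth_rcons.
case: ltngtP le_i => // [/chu //|-> _].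
by rewrite take_size; exists u, v.
Qed.

Lemma concat_chain_flatten (us ps : seq (seq int)) :
  concat_chain us -> ps != [::] -> all (available us) ps ->
  exists vs, [/\ concat_chain (us ++ vs), (size vs <= size ps)%N &
    available (us ++ vs) (flatten ps)].
Proof.
move=> chu; elim: ps => // p [|q ps] IH _.
  by rewrite /= cats0 andbT => avp; exists [::]; rewrite cats0.
move=> /andP[avp /(IH isT)[vs [chv le_vs avv]]].
exists (rcons vs (p ++ flatten (q :: ps))); rewrite -rcons_cat; split.
- apply: concat_chain_rcons => //; apply: available_sub avp => z.
  by rewrite mem_cat => ->.
- by rewrite size_rcons.
- by rewrite /available mem_rcons mem_head orbT.
Qed.

(** Repeated doubling: each halving of [k] costs one entry for the doubled string and one more if
    [k] is odd. *)
Lemma concat_chain_nseq (a : int) (k : nat) : (0 < k)%N ->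
  exists us, [/\ concat_chain us, (size us <= 2 * trunc_log 2 k)%N &
    available us (nseq k a)].
Proof.
have [e] := ubnP k; elim: e k => // e IH k lt_k k_gt0.
have [->|k_gt1] : k = 1%N \/ (1 < k)%N by lia.
  by exists [::]; split=> //.
have [||us [chu le_us av]] := IH k./2; try lia.
have log_k : trunc_log 2 k = (trunc_log 2 k./2).+1.
  by rewrite trunc_log2S.
have av1 : available (rcons us (nseq k./2 a ++ nseq k./2 a)) (nseq k./2.*2 a).
  by rewrite -addnn nseqD /available mem_rcons mem_head orbT.
have chu1 := concat_chain_rcons chu av av.
have [kodd|keven] := boolP (odd k); last first.
  exists (rcons us (nseq k./2 a ++ nseq k./2 a)); split=> //.
    by rewrite size_rcons; lia.
  by move: av1; rewrite (_ : k./2.*2 = k) //; lia.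
exists (rcons (rcons us (nseq k./2 a ++ nseq k./2 a)) ([:: a] ++ nseq k./2.*2 a)).
split.
- by apply: concat_chain_rcons.
- by rewrite !size_rcons; lia.
- rewrite (_ : nseq k a = [:: a] ++ nseq k./2.*2 a); last first.
    by rewrite -(nseqD 1) (_ : 1 + k./2.*2 = k)%N //; lia.
  by rewrite /available mem_rcons mem_head orbT.
Qed.

Section Grammar.
Variable us : seq (seq int).
Local Notation g := (size us).
Hypothesis chain_us : concat_chain us.

Definition expansion (A : symbol g) : seq int :=
  match A with inl a => [:: a] | inr X => nth [::] us X end.

Definition below (X : 'I_g) (A : symbol g) : bool :=
  if A is inr Y then (Y < X)%N else true.

Lemma available_symbol (X : 'I_g) (v : seq int) :
  available (take X us) v -> exists2 A, expansion A = v & below X A.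
Proof.
case/orP => [|/nthP - /(_ [::]) [i]].
  by case: v => [|a []] // _; exists (inl a).
rewrite size_take ltn_ord => lt_i <-.
by exists (inr (Ordinal (ltn_trans lt_i (ltn_ord X)))); rewrite //= nth_take.
Qed.

Lemma rule_existence (X : 'I_g) : exists AB : symbol g * symbol g,
  nth [::] us X = expansion AB.1 ++ expansion AB.2 /\ below X AB.1 && below X AB.2.
Proof.
have [u [v [-> /available_symbol[A <- ltA] /available_symbol[B <- ltB]]]] :=
  chain_us (ltn_ord X).
by exists (A, B); rewrite /= ltA ltB.
Qed.

Definition rule (X : 'I_g) := sval (cid (rule_existence X)).

Definition chain_grammar (X : 'I_g) : grammar :=
  @Grammar g [seq (Y, rule Y) | Y <- enum 'I_g] X.

Lemma chain_grammar_rules (X Y : 'I_g) (AB : symbol g * symbol g) :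
  (Y, AB) \in rules (chain_grammar X) -> AB = rule Y.
Proof. by move=> /mapP[Z _ [-> ->]]. Qed.

(** Every rule splits the expansion of its left side, so induction on the derivation leaves only one
    possible string. *)
Lemma derives_expansion (X : 'I_g) (A : symbol g) (T : seq int) :
  @derives (chain_grammar X) A T -> T = expansion A.
Proof.
elim=> // Y B C u v /chain_grammar_rules BC _ -> _ -> /=.
by rewrite /rule in BC; case: cid BC => -[B' C'] /= [-> _] [-> ->].
Qed.

Lemma expansion_derives (X : 'I_g) (A : symbol g) :
  @derives (chain_grammar X) A (expansion A).
Proof.
case: A => [a|Y]; first exact: (@derives_terminal (chain_grammar X)).
(* Strong induction on the index: the symbols in a rule lie below its left side. *)
have [e] := ubnP Y; elim: e Y => // e IH Y lt_Y.
have sub A : below Y A -> @derives (chain_grammar X) A (expansion A).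
  case: A => [a|Z] /= lt_Z; first exact: (@derives_terminal (chain_grammar X)).
  by apply: IH; apply: leq_trans lt_Z _.
rewrite /=; have : (Y, rule Y) \in rules (chain_grammar X).
  by apply: map_f; rewrite mem_enum.
rewrite /rule; case: cid => -[B C] /= [-> /andP[/sub dB /sub dC]] BC.
exact: (@derives_rule (chain_grammar X) _ _ _ _ _ BC).
Qed.

Lemma chain_grammar_slp (X : 'I_g) : is_slp_for (chain_grammar X) (nth [::] us X).
Proof.
move=> T; split=> [/derives_expansion -> //|->].
exact: (expansion_derives X (inr X)).
Qed.

End Grammar.

(* The query algorithm knows the grammar size, which must therefore be the same
   for all hard strings: useless rules pad the grammar. *)
Lemma concat_chain_slp (us : seq (seq int)) (v : seq int) (g : nat) :
  concat_chain us -> v \in us -> (size us <= g)%N ->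
  exists2 G, grammar_size G = g & is_slp_for G v.
Proof.
move=> chu v_us le_g.
(* Two terminals may be joined anywhere in a chain; the start symbol will be an entry of [us], so
   the padding is never reached. *)
pose vs := us ++ nseq (g - size us) [:: 0; 0].
have size_vs : size vs = g by rewrite size_cat size_nseq subnKC.
have chv : concat_chain vs.
  apply: concat_chain_cat => // i; rewrite size_nseq => lt_i.
  by exists [:: 0], [:: 0]; rewrite nth_nseq lt_i.
have lt_idx : (index v vs < size vs)%N by rewrite index_mem mem_cat v_us.
exists (chain_grammar chv (Ordinal lt_idx)) => //.
have := chain_grammar_slp chv (Ordinal lt_idx).
by rewrite /= nth_index // -index_mem.
Qed.

(** * Hard strings *)

Section Tower.
Variables (a b : int) (m L : nat).

Definition letter (z : bool) : int := if z then b else a.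

(* The two orders of the letters around [u] have the same letter count, so that
   the bit [z] only shows up in the prefixes ending inside [u]. *)
Definition block (z : bool) (u : seq int) : seq int :=
  letter z :: u ++ [:: letter (~~ z)].

Definition blocks (z : nat -> bool) (u : seq int) (k : nat) : seq int :=
  flatten [seq block (z l) u | l <- iota 0 k].

(* The run of m + 1 letters lets a select query return the rank at the position
   of the run as an offset inside the run, since that rank varies by at most m. *)
Fixpoint tower (x : nat -> nat -> bool) (j : nat) : seq int :=
  if j is j'.+1 then blocks (x j') (tower x j') L else nseq m.+1 b.

(** The part of [tower] before the innermost run reached by following the digits [d] down the
    levels. *)
Fixpoint tower_prefix (x : nat -> nat -> bool) (d : nat -> nat) (j : nat) :
    seq int :=
  if j is j'.+1 then
    blocks (x j') (tower x j') (d j') ++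
    letter (x j' (d j')) :: tower_prefix x d j'
  else [::].

Lemma size_blocks z u k : size (blocks z u k) = (k * (size u).+2)%N.
Proof.
rewrite /blocks; elim: k 0%N => //= k IH i.
by rewrite !size_cat /= IH; lia.
Qed.

Lemma size_tower x y j : size (tower x j) = size (tower y j).
Proof. by elim: j => //= j IH; rewrite !size_blocks IH. Qed.

(** Independence of the table lets the queried position be computed from the digits alone. *)
Lemma size_tower_prefix x y d j :
  size (tower_prefix x d j) = size (tower_prefix y d j).
Proof.
by elim: j => //= j IH; rewrite !size_cat !size_blocks /= IH (size_tower x y).
Qed.

Lemma tower_cat x d j : (forall i, (i < j)%N -> (d i < L)%N) ->
  exists v, tower x j = tower_prefix x d j ++ nseq m.+1 b ++ v.
Proof.
elim: j => [|j IH] d_lt; first by exists [::]; rewrite cats0.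
have [|v towerE] := IH; first by move=> i lt_i; apply: d_lt; lia.
exists (v ++ letter (~~ x j (d j)) ::
  flatten [seq block (x j l) (tower x j) | l <- iota (d j).+1 (L - (d j).+1)]).
rewrite /= /blocks -[in iota 0 L](subnKC (d_lt j (ltnSn j))) -addn1 iotaD.
rewrite map_cat flatten_cat iotaD map_cat flatten_cat /= cats0 !add0n addn1.
rewrite -!catA; congr (_ ++ _); rewrite {1}/block {1}towerE /=.
by rewrite -!catA /= -!catA.
Qed.

(** A nonempty copy with its two letters is at most three times as long as the copy, so a level
    costs a factor of at most 3L. *)
Lemma size_tower_le x j : (0 < L)%N -> (size (tower x j) <= m.+1 * (3 * L) ^ j)%N.
Proof.
move=> L_gt0; have tower_gt0 i : (0 < size (tower x i))%N.
  by elim: i => [|i IH] /=; rewrite ?size_nseq // size_blocks; nia.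
elim: j => [|j IH] /=; first by rewrite size_nseq muln1.
by rewrite size_blocks expnS; have := tower_gt0 j; nia.
Qed.

Lemma tower_letters x j : {subset tower x j <= [:: a; b]}.
Proof.
have letterP z : letter z \in [:: a; b] by rewrite !inE; case: z; rewrite eqxx ?orbT.
elim: j => [|j IH] c.
  by rewrite (mem_nseq m.+1) !inE => /andP[_ ->]; rewrite orbT.
rewrite /=.
move=> /flattenP[u /mapP[l _ ->]]; rewrite inE mem_cat inE.
by case/or3P => [/eqP ->|/IH|/eqP ->].
Qed.

(** A level reuses one string L times, so it adds at most 3L entries while the length grows by a
    factor of at least L. *)
Lemma tower_chain x j : (0 < L)%N ->
  exists us, [/\ concat_chain us, (size us <= m.+1 + j * (3 * L))%N &
    available us (tower x j)].
Proof.
move=> L_gt0; elim: j => [|j [us [chu le_us avu]]].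
  have [//|||vs] := @concat_chain_flatten [::] (nseq m.+1 [:: b]) => //.
    by rewrite all_nseq.
  rewrite size_nseq /= => -[chv le_vs avv]; exists vs; split=> //.
    by rewrite mul0n addn0.
  move: avv; rewrite -/(nseq m.+1 b) (_ : b :: _ = nseq m.+1 b) //=.
  by congr cons; elim: m => //= k ->.
pose ps := flatten [seq [:: [:: letter (x j l)]; tower x j; [:: letter (~~ x j l)]] |
  l <- iota 0 L].
have size_ps : size ps = (3 * L)%N.
  suff sz : forall i k, size (flatten [seq [:: [:: letter (x j l)]; tower x j;
      [:: letter (~~ x j l)]] | l <- iota i k]) = (3 * k)%N by exact: sz.
  by move=> i k; elim: k i => //= k IH i; rewrite IH; lia.
have [||vs [chv le_vs avv]] := @concat_chain_flatten us ps chu.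
- by rewrite -size_eq0 size_ps; lia.
- by apply/allP => u /flattenP[v /mapP[l _ ->]] /[!inE] /or3P[] /eqP ->.
exists (us ++ vs); split=> //.
  by rewrite size_cat; lia.
rewrite (_ : tower x j.+1 = flatten ps) // /= /blocks /ps.
by elim: (L) 0%N => //= k IH i; rewrite IH /block /= -!catA.
Qed.

Hypothesis neq_ab : a != b.

Lemma count_block z u : count_mem b (block z u) = (count_mem b u).+1.
Proof.
rewrite /= count_cat /= addn0.
by case: z; rewrite /= eqxx (negbTE neq_ab) /=; lia.
Qed.

Lemma count_blocks z u k : count_mem b (blocks z u k) = (k * (count_mem b u).+1)%N.
Proof.
rewrite /blocks; elim: k 0%N => // k IH i.
by rewrite [iota _ _]/= [map _ _]/= [flatten _]/= -cat_cons count_cat count_block IH mulSn.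
Qed.

Lemma count_tower x y j : count_mem b (tower x j) = count_mem b (tower y j).
Proof. by elim: j => //= j IH; rewrite !count_blocks IH. Qed.

(** Complete blocks have a count independent of the table; only the opening letters of the blocks
    entered depend on it, one bit per level. *)
Lemma count_tower_prefix x d j :
  count_mem b (tower_prefix x d j) =
  (count_mem b (tower_prefix (fun _ _ => false) d j) + \sum_(i < j) x i (d i))%N.
Proof.
elim: j => [|j IH]; first by rewrite big_ord0.
rewrite big_ord_recr /= !count_cat !count_blocks /= IH.
rewrite (count_tower x (fun _ _ => false)) (negbTE neq_ab).
by case: (x j (d j)); rewrite /= ?eqxx ?(negbTE neq_ab); lia.
Qed.

End Tower.

(** * Partial sums and select on simple strings *)

Lemma psumE (S : seq int) (i : nat) :
  (i <= size S)%N -> psum S i = \sum_(c <- take i S) c.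
Proof.
move=> le_i; rewrite /psum big_add1 /= [RHS](big_nth 0) size_takel //.
by apply: eq_big_nat => j /andP[_ lt_j]; rewrite nth_take.
Qed.

(** This reduces partial sums to rank: for a given length they are affine in the number of letters
    [b]. *)
Lemma sum_two_letters (a b : int) (s : seq int) : {subset s <= [:: a; b]} ->
  \sum_(c <- s) c = a * (size s)%:Z + (b - a) * (count_mem b s)%:Z.
Proof.
elim: s => [|c s IH] sub; first by rewrite big_nil !mulr0.
rewrite big_cons IH => [|d ds]; last by apply: sub; rewrite inE ds orbT.
have := sub c (mem_head _ _); rewrite !inE /= => /orP[/eqP ->|/eqP ->].
  by rewrite intS PoszD; have [->|_] := eqVneq a b; rewrite ?subrr /=; ring.
by rewrite eqxx intS PoszD /=; ring.
Qed.

Lemma select_run (c : int) (u v : seq int) (k i : nat) : (i < k)%N ->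
  select c (u ++ nseq k c ++ v) (count_mem c u + i).+1 = (size u + i).+1.
Proof.
move=> lt_i; rewrite /select /occurrences !size_cat size_nseq !iotaD !filter_cat /=.
have sz : size [seq j <- iota 1 (size u) | nth 0 (u ++ nseq k c ++ v) j.-1 == c]
    = count_mem c u.
  rewrite size_filter -[1%N]addn0 iotaDl count_map -[in RHS](mkseq_nth 0 u) count_map.
  apply: eq_in_count => j; rewrite mem_iota /= add0n => lt_j.
  by rewrite /= nth_cat lt_j.
have -> : [seq j <- iota (1 + size u) k | nth 0 (u ++ nseq k c ++ v) j.-1 == c]
    = iota (1 + size u) k.
  apply/all_filterP/allP => j; rewrite mem_iota => /andP[le_j lt_j].
  rewrite nth_cat ltnNge (_ : size u <= j.-1)%N /=; last lia.
  rewrite nth_cat size_nseq nth_nseq (_ : j.-1 - size u < k)%N ?eqxx //; lia.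
rewrite nth_cat sz ltnNge leq_addr /= addKn nth_cat size_iota lt_i nth_iota //.
Qed.

(** * Padded hard strings and the queries on them *)

Section HardString.
Variables (a b : int) (m L n : nat).
Hypotheses (neq_ab : a != b) (L_gt0 : (0 < L)%N).
Hypothesis tower_le : (m.+1 * (3 * L) ^ m <= n)%N.

Definition bit (x : table m L) (j l : nat) : bool :=
  if (insub j, insub l) is (Some j', Some l') then x (j', l') else false.

Definition digit (i : digits m L) (j : nat) : nat :=
  if insub j is Some j' then i j' else 0%N.

(** Padding at the end gives all tables strings of the same length n without moving the runs. *)
Definition hard_string (x : table m L) : seq int :=
  let u := tower a b m L (bit x) m in u ++ nseq (n - size u) a.

Lemma size_hard_string x : size (hard_string x) = n.
Proof.
rewrite size_cat size_nseq subnKC //.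
exact: leq_trans (size_tower_le _ _ _ _ _ L_gt0) tower_le.
Qed.

Lemma hard_string_letters x : {subset hard_string x <= [:: a; b]}.
Proof.
move=> c; rewrite mem_cat => /orP[/tower_letters //|].
by rewrite mem_nseq !inE => /andP[_ ->].
Qed.

Lemma hard_string_slp x g : (1 < n)%N ->
  (m.+1 + m * (3 * L) + 2 * trunc_log 2 n + 1 <= g)%N ->
  exists2 G, grammar_size G = g & is_slp_for G (hard_string x).
Proof.
move=> n_gt1 le_g; have := size_hard_string x; rewrite /hard_string.
have [us [chu le_us avu]] := tower_chain a b m (bit x) m L_gt0.
have [k_le0|k_gt0] := leqP (n - size (tower a b m L (bit x) m)) 0.
  rewrite (_ : (_ - _)%N = 0%N) ?cats0; last lia.
  move=> sz; apply: (concat_chain_slp chu); last lia.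
  by move: avu; rewrite /available sz; case: eqP => //; lia.
have [vs [chv le_vs avv]] := concat_chain_nseq a k_gt0 => _.
have chuv := concat_chain_cat chu chv.
have {}avu : available (us ++ vs) (tower a b m L (bit x) m).
  by apply: available_sub avu => z; rewrite mem_cat => ->.
have {}avv : available (us ++ vs) (nseq (n - size (tower a b m L (bit x) m)) a).
  by apply: available_sub avv => z; rewrite mem_cat orbC => ->.
apply: (concat_chain_slp (concat_chain_rcons chuv avu avv)).
  by rewrite mem_rcons mem_head.
have := leq_trunc_log 2 (leq_subr (size (tower a b m L (bit x) m)) n).
by rewrite size_rcons size_cat; lia.
Qed.

Local Notation zeros := (fun _ _ => false).

(** The zero table serves as reference: the position is the same for all tables, and the rank there
    differs from [base_rank] by the path sum. *)
Definition run_position (i : digits m L) : nat :=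
  size (tower_prefix a b m L zeros (digit i) m).

Definition base_rank (i : digits m L) : nat :=
  count_mem b (tower_prefix a b m L zeros (digit i) m).

Lemma hard_string_split x i : exists u v,
  [/\ hard_string x = u ++ nseq m.+1 b ++ v, size u = run_position i &
    count_mem b u = (base_rank i + path_sum x i)%N].
Proof.
have [|v towerE] := @tower_cat a b m L (bit x) (digit i) m.
  by move=> j lt_j; rewrite /digit insubT ltn_ord.
exists (tower_prefix a b m L (bit x) (digit i) m),
  (v ++ nseq (n - size (tower a b m L (bit x) m)) a); split.
- by rewrite /hard_string {1}towerE -!catA.
- exact: size_tower_prefix.
- rewrite count_tower_prefix //; congr addn; apply: eq_bigr => j _.
  by rewrite /digit valK /bit !valK.
Qed.

Lemma path_sum_le (x : table m L) i : (path_sum x i <= m)%N.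
Proof.
rewrite -[leqRHS]card_ord -[leqRHS]muln1 -sum_nat_const; apply: leq_sum => j _.
exact: leq_b1.
Qed.

(** The query may depend on the digits but not on the table, and its answer need only separate path
    sums. *)
Definition reveals_path_sums (P : problem) : Prop :=
  exists q : digits m L -> query P,
    (forall x i, legal (hard_string x) (q i)) /\
    (forall x y i, solution (hard_string x) (q i) = solution (hard_string y) (q i) ->
       path_sum x i = path_sum y i).

Lemma run_position_lt i : (run_position i < n)%N.
Proof.
have [u [v [sE <- _]]] := hard_string_split [ffun=> false] i.
by rewrite -(size_hard_string [ffun=> false]) sE !size_cat size_nseq; lia.
Qed.

Lemma rank_hard_string x i :
  rank b (hard_string x) (run_position i).+1 = (base_rank i + path_sum x i).+1.
Proof.
have [u [v [-> <- <-]]] := hard_string_split x i.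
rewrite /rank [nseq m.+1 b ++ v]/= -cat_rcons take_size_cat ?size_rcons //.
by rewrite -cats1 count_cat /= eqxx addn0 addn1.
Qed.

(** The rank before the run is between [base_rank i] and [base_rank i + m], so the requested [b]
    always falls among the m + 1 letters of the run. *)
Lemma select_hard_string x i :
  select b (hard_string x) (base_rank i + m).+1 =
  (run_position i + (m - path_sum x i)).+1.
Proof.
have [u [v [-> <- countE]]] := hard_string_split x i.
have le_m := path_sum_le x i.
rewrite -(@select_run b u v m.+1) ?countE; last lia.
by congr select; lia.
Qed.

Lemma psum_reveals : reveals_path_sums psum_problem.
Proof.
exists (fun i => (run_position i).+1); split=> [x i|x y i] /=.
  by rewrite size_hard_string run_position_lt.
rewrite !psumE ?size_hard_string ?run_position_lt //.
rewrite !(@sum_two_letters a b); try by move=> c /mem_take /hard_string_letters.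
(* Both prefixes have the same length, so the multiples of [a] cancel; then the nonzero factor
   [b - a] is removed. *)
rewrite !size_takel ?size_hard_string ?run_position_lt // => /addrI.
move=> /mulfI; rewrite subr_eq0 eq_sym neq_ab => /(_ isT) [].
rewrite -!/(rank _ _ _) !rank_hard_string; lia.
Qed.

Lemma rank_reveals (Sigma : nat -> seq int) : b \in Sigma n ->
  reveals_path_sums (rank_problem Sigma).
Proof.
move=> b_in; exists (fun i => (b, (run_position i).+1)); split=> [x i|x y i] /=.
  by rewrite size_hard_string run_position_lt b_in.
by rewrite !rank_hard_string => -[/addnI].
Qed.

Lemma select_reveals : reveals_path_sums select_problem.
Proof.
exists (fun i => (b, (base_rank i + m).+1)); split=> [x i|x y i] /=.
  have [u [v [-> _ countE]]] := hard_string_split x i.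
  by rewrite !count_cat countE count_nseq /= eqxx; lia.
have := path_sum_le x i; have := path_sum_le y i.
by rewrite !select_hard_string; lia.
Qed.

End HardString.

(** * Asymptotics *)

(** With e = log l it suffices that 12(e+1) <= 2^e, which holds from e = 7 on, that is, from l =
    128. *)
Lemma pow12_le_exp2 (l : nat) : (128 <= l)%N -> (l ^ 12 <= 2 ^ l)%N.
Proof.
move=> l_ge; set e := trunc_log 2 l.
have e_ge : (7 <= e)%N by rewrite trunc_log_max.
have le_e : (12 * e.+1 <= 2 ^ e)%N.
  elim: e e_ge => // e IH; rewrite leq_eqVlt => /orP[/eqP <- //|lt_e].
  by have := IH lt_e; rewrite expnS; lia.
have le_l : (2 ^ e <= l)%N by rewrite trunc_logP //; lia.
have lt_l : (l < 2 ^ e.+1)%N by rewrite trunc_log_ltn.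
apply: (@leq_trans ((2 ^ e.+1) ^ 12)); first by rewrite leq_exp2r // ltnW.
by rewrite -expnM leq_exp2l // mulnC (leq_trans le_e).
Qed.

(** * Choice of parameters *)

(** The type of words depends on [size S]; passing to n gives all hard strings the same type. *)
Lemma instance_memory (P : problem) (Sigma : nat -> seq int) (D : data_structure P)
    (t : nat -> nat) (n s : nat) (S : seq int) (G : grammar) :
  solves Sigma D -> runs_in_time Sigma D t -> instance Sigma S G -> size S = n ->
  (size (memory D S G) <= s)%N ->
  exists mem : seq (word (word_size D n)), (size mem <= s)%N /\
    forall q, legal S q ->
      run mem (algorithm D n (grammar_size G) q) = solution S q /\
      (cost mem (algorithm D n (grammar_size G) q) <= t n)%N.
Proof.
move=> sol time inst <- le_s; exists (memory D S G); split=> // q lq.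
by split; [apply: sol|apply: time].
Qed.

Lemma instance_time (P : problem) (Sigma : nat -> seq int) (D : data_structure P)
    (t : nat -> nat) (a b : int) (m r n g s : nat) :
  solves Sigma D -> runs_in_time Sigma D t ->
  a != b -> a \in Sigma n -> b \in Sigma n -> (0 < r)%N -> (1 < n)%N ->
  (m.+1 * (3 * r ^ 2) ^ m <= n)%N ->
  (m.+1 + m * (3 * r ^ 2) + 2 * trunc_log 2 n + 1 <= g)%N ->
  (forall S G, instance Sigma S G -> size S = n -> grammar_size G = g ->
     (size (memory D S G) <= s)%N) ->
  reveals_path_sums a b m (r ^ 2) n P ->
  (r ^ m <= s.+1 ^ t n)%N \/ (2 ^ r < r ^ m * 2 ^ (word_size D n * t n))%N.
Proof.
move=> sol time neq_ab a_in b_in r_gt0 n_gt1 tower_le slp_le space [q [q_legal q_sum]].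
have L_gt0 : (0 < r ^ 2)%N by rewrite expn_gt0 r_gt0.
have mem_ex (x : table m (r ^ 2)) : exists mem : seq (word (word_size D n)),
    (size mem <= s)%N /\
    forall i, run mem (algorithm D n g (q i)) = solution (hard_string a b n x) (q i) /\
      (cost mem (algorithm D n g (q i)) <= t n)%N.
  have [G Gg slpG] := hard_string_slp neq_ab L_gt0 tower_le x n_gt1 slp_le.
  have sz := size_hard_string a b L_gt0 tower_le x.
  have inst : instance Sigma (hard_string a b n x) G.
    split=> // c /hard_string_letters; rewrite sz !inE.
    by case/orP => /eqP ->.
  have [mem [le_s memP]] := instance_memory sol time inst sz (space _ _ inst sz Gg).
  by exists mem; split=> // i; rewrite -Gg; apply: memP.
pose mem x := sval (cid (mem_ex x)).
have memP x := svalP (cid (mem_ex x)).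
apply: (@probe_lower_bound _ m r s (t n) _ mem (fun i => algorithm D n g (q i))).
- by move=> x; have [] := memP x.
- by move=> x i; have [_ /(_ i)[]] := memP x.
- move=> x y i eq_run; apply: q_sum.
  have [_ /(_ i)[<- _]] := memP x.
  by have [_ /(_ i)[<- _]] := memP y.
Qed.

(** The parameters are r = l^4, L = l^8 and grammar size l^10. Few address sequences give l^(4m) <=
    l^(K t); otherwise the bits read are too few for l^4. *)
Lemma time_ge_levels (P : problem) (Sigma : nat -> seq int) (D : data_structure P)
    (t : nat -> nat) (a b : int) (n K : nat) :
  let l := trunc_log 2 n in let m := trunc_log (l ^ 12) n in
  solves Sigma D -> runs_in_time Sigma D t ->
  a != b -> a \in Sigma n -> b \in Sigma n -> (128 <= l)%N -> (0 < K)%N ->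
  (word_size D n <= l ^ 2)%N ->
  (forall S G, instance Sigma S G -> size S = n -> grammar_size G = (l ^ 10)%N ->
     (size (memory D S G) < l ^ K)%N) ->
  (forall m L, (0 < L)%N -> (m.+1 * (3 * L) ^ m <= n)%N ->
     reveals_path_sums a b m L n P) ->
  (m <= K * t n)%N.
Proof.
move=> l m sol time neq_ab a_in b_in l_ge K_gt0 w_le space rev.
have n_gt0 : (0 < n)%N by move: l_ge; rewrite /l; case: (n).
have n_lt : (n < 2 ^ l.+1)%N by rewrite trunc_log_ltn.
have l_gt1 : (1 < l)%N by lia.
have l12_gt1 : (1 < l ^ 12)%N by rewrite (ltn_exp2l 0).
have m_pow : ((l ^ 12) ^ m <= n)%N by rewrite trunc_logP.
have m_le : (m <= l)%N.
  have [->//|m_gt0] := posnP m.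
  by rewrite trunc_log_max // (leq_trans _ m_pow) // leq_exp2r.
have r_gt0 : (0 < l ^ 4)%N by rewrite expn_gt0; lia.
have n_gt1 : (1 < n)%N by move: l_ge; rewrite /l; case: (n) => [|[]].
have tower_le : (m.+1 * (3 * (l ^ 4) ^ 2) ^ m <= n)%N.
  (* The factor m + 1 is absorbed by 2^m, and 6 l^8 <= l^12. *)
  apply: leq_trans m_pow; apply: (@leq_trans ((2 * (3 * (l ^ 4) ^ 2)) ^ m)).
    by rewrite (expnMn 2) leq_mul2r ltn_expl ?orbT.
  have [->//|m_gt0] := posnP m.
  rewrite leq_exp2r // -expnM mulnA (expnD l 4 8) leq_mul2r.
  by rewrite (@leq_trans (l ^ 1)) ?leq_exp2l ?orbT // expn1; lia.
have slp_le : (m.+1 + m * (3 * (l ^ 4) ^ 2) + 2 * trunc_log 2 n + 1 <= l ^ 10)%N.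
  rewrite -/l -expnM (expnD l 2 8); set u := (l ^ (4 * 2))%N.
  have u_gt0 : (0 < u)%N by rewrite expn_gt0; lia.
  have mu_le : (m * u <= l * u)%N by rewrite leq_mul2r m_le orbT.
  have lu_ge : (l <= l * u)%N by rewrite leq_pmulr.
  have llu_ge : (128 * (l * u) <= l ^ 2 * u)%N.
    by rewrite mulnA leq_mul2r -mulnn leq_mul2r l_ge !orbT.
  rewrite -/u; lia.
have space' S G : instance Sigma S G -> size S = n -> grammar_size G = (l ^ 10)%N ->
    (size (memory D S G) <= (l ^ K).-1)%N.
  by move=> inst sz gs; have := space S G inst sz gs; lia.
have rev' : reveals_path_sums a b m ((l ^ 4) ^ 2) n P.
  by apply: rev => //; rewrite expn_gt0 r_gt0.
have [|] := instance_time sol time neq_ab a_in b_in r_gt0 n_gt1 tower_le slp_le space' rev'.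
- rewrite prednK ?expn_gt0; last lia.
  by rewrite -!expnM leq_exp2l // => le_m; apply: leq_trans le_m; lia.
- move=> lt_r; have r_le : ((l ^ 4) ^ m <= n)%N.
    apply: leq_trans m_pow; have [->//|m_gt0] := posnP m.
    by rewrite leq_exp2r // leq_exp2l.
  have : (2 ^ (l ^ 4) < 2 ^ (l.+1 + word_size D n * t n))%N.
    apply: leq_trans lt_r _; rewrite expnD leq_mul2r.
    by rewrite (leq_trans r_le) ?orbT // ltnW.
  rewrite ltn_exp2l // => lt_l.
  (* If t < m <= l, then l^4 < l + 1 + l^3, which is false. *)
  have [|t_lt] := leqP m (t n); first by move/leq_trans; apply; rewrite leq_pmull.
  have wt_le : (word_size D n * t n <= l ^ 2 * l)%N by rewrite leq_mul //; lia.
  have l4 : (128 * l ^ 3 <= l ^ 4)%N by rewrite (expnS l 3) leq_mul2r l_ge orbT.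
  have l3 : (l ^ 1 <= l ^ 3)%N by rewrite leq_exp2l.
  by move: lt_l wt_le l4 l3; rewrite -expnSr expn1; lia.
Qed.

Section Asymptotics.
Variable R : realType.
Implicit Types (n l m : nat).

Lemma ln_natX (x k : nat) : ln ((x ^ k)%:R : R) = k%:R * ln (x%:R : R).
Proof.
case: x => [|x]; last by rewrite natrX lnXn ?ltr0n // mulr_natl.
case: k => [|k]; first by rewrite expn0 ln1 mul0r.
by rewrite exp0n // !ln0 ?mulr0.
Qed.

Lemma ler_ln_nat (x y : nat) : (0 < x)%N -> (x <= y)%N -> ln (x%:R : R) <= ln (y%:R : R).
Proof.
move=> x_gt0 le_xy; rewrite ler_ln ?ler_nat // posrE ltr0n //.
exact: leq_trans le_xy.
Qed.

Lemma ln2_gt0 : 0 < ln (2%:R : R).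
Proof. by rewrite ln_gt0 // ltr1n. Qed.

Lemma ln_ge_trunc_log n : (0 < n)%N -> (trunc_log 2 n)%:R * ln 2%:R <= ln (n%:R : R).
Proof.
by move=> n_gt0; rewrite -ln_natX ler_ln_nat ?expn_gt0 // trunc_logP.
Qed.

Lemma ln_le_trunc_log n : (0 < n)%N -> ln (n%:R : R) <= 2 * (trunc_log 2 n).+1%:R.
Proof.
move=> n_gt0; apply: (@le_trans _ _ (ln ((2 ^ (trunc_log 2 n).+1)%:R))).
  by rewrite ler_ln_nat // ltnW // trunc_log_ltn.
rewrite ln_natX mulrC ler_wpM2r //.
by rewrite ltW // ln_sublinear.
Qed.

Lemma trunc_log_near_ge (C : R) : \forall n \near \oo%classic, C <= (trunc_log 2 n)%:R.
Proof.
exists (2 ^ Num.bound `|C|)%N => // n /= le_n.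
apply: (@le_trans _ _ (Num.bound `|C|)%:R).
  exact: le_trans (ler_norm C) (ltW (archi_boundP (normr_ge0 C))).
by rewrite ler_nat trunc_log_max.
Qed.

(** From n < l^(12(m+1)), ln n <= 12(m+1) ln l; the constant 48 comes from m + 1 <= 2m and ln l <= 2
    ln ln n. *)
Lemma log_ratio_le n m : let l := trunc_log 2 n in
  (128 <= l)%N -> 1 <= l%:R * ln (2%:R : R) ^+ 2 -> m = trunc_log (l ^ 12) n ->
  0 <= ln (n%:R : R) / ln (ln (n%:R : R)) <= 48%:R * m%:R.
Proof.
move=> l l_ge l_ln2 mE.
have n_gt0 : (0 < n)%N by move: l_ge; rewrite /l; case: (n).
have l_ln : l%:R * ln 2%:R <= ln (n%:R : R) by exact: ln_ge_trunc_log.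
have ln2_lt : ln (2%:R : R) < 2%:R by rewrite ln_sublinear.
have l12_gt1 : (1 < l ^ 12)%N by rewrite (ltn_exp2l 0); lia.
have l_geR : 128%:R <= l%:R :> R by rewrite ler_nat.
have ln_gt1 : 1 < ln (n%:R : R).
  apply: lt_le_trans l_ln; have := ln2_gt0; nra.
have lnln_gt0 : 0 < ln (ln (n%:R : R)) by rewrite ln_gt0.
have m_gt0 : (0 < m)%N.
  rewrite mE trunc_log_max //; rewrite expn1 (leq_trans (pow12_le_exp2 l_ge)) //.
  by rewrite trunc_logP.
have lnl_le : ln (l%:R : R) <= 2 * ln (ln (n%:R : R)).
  rewrite mulr_natl -lnXn ?(lt_trans _ ln_gt1) // ler_ln ?posrE; last 2 first.
  - by rewrite ltr0n; lia.
  - by rewrite exprn_gt0 // (lt_trans _ ln_gt1).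
  (* The assumption on l (ln 2)^2 gives l <= (l ln 2)^2 <= (ln n)^2. *)
  apply: (@le_trans _ _ ((l%:R * ln 2%:R) ^+ 2)).
    by rewrite exprMn expr2 -mulrA ler_peMr // ler0n.
  by rewrite lerXn2r // nnegrE ?mulr_ge0 ?ler0n ?(ltW ln2_gt0) //; lra.
apply/andP; split; first by rewrite divr_ge0 ?(ltW lnln_gt0) //; lra.
rewrite ler_pdivrMr //; apply: (@le_trans _ _ (ln (((l ^ 12) ^ m.+1)%:R))).
  by rewrite ler_ln_nat // ltnW // mE trunc_log_ltn.
rewrite !ln_natX (_ : 48%:R * m%:R * _ = (2 * m)%:R * (12%:R * (2 * ln (ln n%:R)))); last first.
  by rewrite natrM; ring.
have l_gt0 : (0 < l)%N by exact: leq_trans l_ge.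
apply: ler_pM; rewrite ?ler0n ?mulr_ge0 ?ler0n ?ln_ge0 ?ler1n //.
  by rewrite ler_nat mul2n -addnn -addn1 leq_add2l.
by rewrite ler_wpM2l.
Qed.

Lemma needs_time_of_reveals (Sigma : nat -> seq int) (P : problem) :
  (forall n : nat, (1 < size (undup (Sigma n)))%N) ->
  (forall a b m L n, a != b -> b \in Sigma n -> (0 < L)%N ->
     (m.+1 * (3 * L) ^ m <= n)%N -> reveals_path_sums a b m L n P) ->
  needs_time Sigma P (fun n : nat => ln (n%:R : R) / ln (ln (n%:R : R))).
Proof.
move=> hSigma rev D t sol /eqO_exP[Cw Cw_gt0 words] [C [k [n0 space]]] time.
rewrite eqOmegaE qualifE; apply/asboolP.
(* For large n the space C g (ln n)^k is at most l * l^10 * (l^2)^k < l^K. *)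
pose K := (12 + 2 * k)%N.
(* The ratio is at most 48 m, and m <= K t. *)
exists (48 * K%:R)^-1; first by rewrite invr_gt0 mulr_gt0 // ltr0n.
near=> n.
pose l := trunc_log 2 n.
have l_ge : (128 <= l)%N by rewrite -(ler_nat R); rewrite /l; near: n; exact: trunc_log_near_ge.
have l_ln2 : 1 <= l%:R * ln (2%:R : R) ^+ 2.
  rewrite -ler_pdivrMr ?exprn_gt0 ?ln2_gt0 //; rewrite /l; near: n; exact: trunc_log_near_ge.
have Cw_le : 4 * Cw <= l%:R by rewrite /l; near: n; exact: trunc_log_near_ge.
have C_le : `|C| <= l%:R by rewrite /l; near: n; exact: trunc_log_near_ge.
have n_gt0 : (0 < n)%N by move: l_ge; rewrite /l; case: (n).
have l_gt1 : (1 < l)%N by exact: leq_trans l_ge.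
have l_geR : 128%:R <= l%:R :> R by rewrite ler_nat.
have ln_ge0 : 0 <= ln (n%:R : R) by rewrite ln_ge0 // ler1n.
have ln_le : ln (n%:R : R) <= 4 * l%:R.
  by apply: le_trans (ln_le_trunc_log n_gt0) _; rewrite -/l -natr1; lra.
have w_le : (word_size D n <= l ^ 2)%N.
  have : `|(word_size D n)%:R : R| <= Cw * `|ln (n%:R : R)| by near: n.
  rewrite !ger0_norm // => w_le; rewrite -(ler_nat R) natrX.
  apply: (le_trans w_le); apply: (@le_trans _ _ (Cw * (4 * l%:R))).
    by rewrite ler_wpM2l // ltW.
  by rewrite expr2 mulrA ler_wpM2r // mulrC.
have [a [b [neq_ab a_in b_in]]] : exists a b, [/\ a != b, a \in Sigma n & b \in Sigma n].
  have := hSigma n; have := undup_uniq (Sigma n).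
  case E : (undup (Sigma n)) => [|a [|b s]] //= /andP[ab _] _.
  exists a, b; move: ab; rewrite inE negb_or => /andP[-> _].
  by rewrite -!(mem_undup (Sigma n)) E !inE !eqxx orbT.
have le_m : (trunc_log (l ^ 12) n <= K * t n)%N.
  apply: (time_ge_levels sol time neq_ab a_in b_in l_ge) => //.
    move=> S G inst sz gs; rewrite -(ltr_nat R).
    have le_sz : (n0 <= size S)%N by rewrite sz; near: n; exact: nbhs_infty_ge.
    apply: le_lt_trans (space S G inst le_sz) _; rewrite gs sz -/l.
    have ln_sq : ln (n%:R : R) <= l%:R ^+ 2.
      by apply: le_trans ln_le _; rewrite expr2 ler_wpM2r //; lra.
    apply: (@le_lt_trans _ _ (l ^ (11 + 2 * k))%:R); last first.
      by rewrite ltr_nat (ltn_exp2l _ _ l_gt1) ltn_add2r.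
    rewrite expnD (expnS l 10) expnM natrM [X in _ <= X * _]natrM.
    apply: (@le_trans _ _ (l%:R * (l ^ 10)%:R * ln n%:R ^+ k)).
      rewrite ler_wpM2r ?exprn_ge0 // ler_wpM2r ?ler0n //.
      exact: le_trans (ler_norm C) C_le.
    by rewrite ler_wpM2l ?mulr_ge0 ?ler0n // !natrX lerXn2r // nnegrE exprn_ge0.
  by move=> m L L_gt0 tower_le; exact: rev.
have /andP[ratio_ge0 ratio_le] := log_ratio_le l_ge l_ln2 erefl.
rewrite ger0_norm // ger0_norm // mulrC ler_pdivrMr ?mulr_gt0 ?ltr0n //.
apply: le_trans ratio_le _.
by rewrite mulrCA ler_wpM2l // -natrM ler_nat [leqRHS]mulnC.
Unshelve. all: by end_near.
Qed.

End Asymptotics.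

Theorem theorem6 (R : realType) (Sigma : nat -> seq int)
    (hSigma : forall n : nat, (1 < size (undup (Sigma n)))%N) :
  let f := fun n : nat => ln (n%:R : R) / ln (ln (n%:R : R)) in
  [/\ needs_time Sigma psum_problem f,
      needs_time Sigma (rank_problem Sigma) f &
      needs_time Sigma select_problem f].
Proof.
move=> f; split; apply: needs_time_of_reveals => // a b m L n neq_ab b_in L_gt0 le_n.
- exact: psum_reveals.
- exact: rank_reveals.
- exact: select_reveals.
Qed.
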